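(* Let $h=h(t,x-\xi)=e^{-\frac{(x-\xi)^{2}}{4t}}$ for $t>0$ and $x,\xi\in\mathbb{R}$. Then $$\frac{h'_{t}h'_{t}}{h}=h''_{tt}+\frac{2}{t}h'_{t},\qquad \frac{h'_{x}h'_{x}}{h}=h''_{xx}+\frac{1}{2t}h,\qquad \frac{h'_{t}h'_{x}}{h}=h''_{tx}+\frac{1}{t}h'_{x}.$$
   Context: Primes with subscripts denote partial derivatives with respect to the indicated variables $t$ and $x$, with $\xi$ fixed. *)

(* Defs.v *)
From Stdlib Require Import Reals.
From Coquelicot Require Import Coquelicot.
Open Scope R_scope.

(** Only values at [t > 0] are meaningful. As [t > 0] is an open condition, the
    values at [t <= 0] do not affect the partial derivatives at points [t > 0]. *)
Definition h (t y : R) : R := exp (- (y ^ 2 / (4 * t))).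

(** For [f] a function of [(t, x)]. [Derive] is total; it is the usual derivative
    at every point where the latter exists, which is the case for all derivatives
    of [h] at points [t > 0]. *)
Definition partial_t (f : R -> R -> R) (t x : R) : R := Derive (fun s => f s x) t.
Definition partial_x (f : R -> R -> R) (t x : R) : R := Derive (fun y => f t y) x.

(* Main.v *)
Require Import Defs.
From Stdlib Require Import Reals Lra.
From Coquelicot Require Import Coquelicot.
Open Scope R_scope.

(** Write [h] as e^φ with φ = -(x - ξ)²/(4t). For any two variables a, b, h'_a h'_b / h = φ'_a φ'_b
    h = h''_ab - φ''_ab h, and here φ''_tt = -(2/t) φ'_t, φ''_xx = -1/(2t), φ''_tx = -(1/t) φ'_x.
    The code makes this explicit: each derivative is computed as a rational function of t and x - ξ
    times [h], which leaves rational identities. *)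

Lemma partial_t_h (xi t x : R) : 0 < t ->
  partial_t (fun t x => h t (x - xi)) t x
    = (x - xi) ^ 2 / (4 * t ^ 2) * h t (x - xi).
Proof.
  intros ht; apply is_derive_unique; unfold h.
  auto_derive; [lra|].
  unfold Rdiv, Rminus; cbn [pow]; field; lra.
Qed.

Lemma partial_x_h (xi t x : R) : 0 < t ->
  partial_x (fun t x => h t (x - xi)) t x
    = - (x - xi) / (2 * t) * h t (x - xi).
Proof.
  intros ht; apply is_derive_unique; unfold h.
  auto_derive; [trivial|].
  unfold Rdiv, Rminus; cbn [pow]; field; lra.
Qed.

Lemma partial_tt_h (xi t x : R) : 0 < t ->
  partial_t (partial_t (fun t x => h t (x - xi))) t x
    = ((x - xi) ^ 4 / (16 * t ^ 4) - (x - xi) ^ 2 / (2 * t ^ 3))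
      * h t (x - xi).
Proof.
  intros ht; unfold partial_t at 1.
  (* The closed form of the inner derivative is known only for s > 0, so it replaces that derivative
     only near t, on an open half-line. *)
  rewrite (Derive_ext_loc _ (fun s => (x - xi) ^ 2 / (4 * s ^ 2) * h s (x - xi))).
  - apply is_derive_unique; unfold h.
    auto_derive; [repeat split; nra|].
    unfold Rdiv, Rminus; cbn [pow]; field; lra.
  - apply (filter_imp (fun s => 0 < s)).
    + intros s hs; exact (partial_t_h xi s x hs).
    + exact (open_gt 0 t ht).
Qed.

Lemma partial_xx_h (xi t x : R) : 0 < t ->
  partial_x (partial_x (fun t x => h t (x - xi))) t x
    = ((x - xi) ^ 2 / (4 * t ^ 2) - 1 / (2 * t)) * h t (x - xi).
Proof.
  intros ht; unfold partial_x at 1.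
  rewrite (Derive_ext _ (fun y => - (y - xi) / (2 * t) * h t (y - xi)))
    by (intros y; exact (partial_x_h xi t y ht)).
  apply is_derive_unique; unfold h.
  auto_derive; [trivial|].
  unfold Rdiv, Rminus; cbn [pow]; field; lra.
Qed.

Lemma partial_tx_h (xi t x : R) : 0 < t ->
  partial_x (partial_t (fun t x => h t (x - xi))) t x
    = ((x - xi) / (2 * t ^ 2) - (x - xi) ^ 3 / (8 * t ^ 3)) * h t (x - xi).
Proof.
  intros ht; unfold partial_x at 1.
  rewrite (Derive_ext _ (fun y => (y - xi) ^ 2 / (4 * t ^ 2) * h t (y - xi)))
    by (intros y; exact (partial_t_h xi t y ht)).
  apply is_derive_unique; unfold h.
  auto_derive; [trivial|].
  unfold Rdiv, Rminus; cbn [pow]; field; lra.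
Qed.

Theorem lemma1 (t x xi : R) (ht : 0 < t) :
  let H : R -> R -> R := fun t x => h t (x - xi) in
  partial_t H t x * partial_t H t x / H t x
    = partial_t (partial_t H) t x + 2 / t * partial_t H t x
  /\
  partial_x H t x * partial_x H t x / H t x
    = partial_x (partial_x H) t x + 1 / (2 * t) * H t x
  /\
  partial_t H t x * partial_x H t x / H t x
    = partial_x (partial_t H) t x + 1 / t * partial_x H t x.
Proof.
  intros H; unfold H.
  rewrite partial_tt_h, partial_xx_h, partial_tx_h, partial_t_h, partial_x_h
    by exact ht.
  (* [field] treats [h t (x - xi)] as an atom; dividing by it only requires that it be nonzero. *)
  assert (hpos : 0 < h t (x - xi)) by apply exp_pos.
  repeat split; field; lra.
Qed.
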